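(* Let $A_1,\dots,A_m\in S^n$. If there exist $\eta>0$, $\varepsilon>0$, real numbers $t_1,t_2,\mu_1,\dots,\mu_m$, and matrices $\Phi,Q\in S^n$, $V,\Theta\in\mathbb{R}^{n\times n}$ and $M_i\in\mathbb{R}^{n\times n}$, $i=1,\dots,8$, such that $$\left\lceil\operatorname{tr}(\Phi)-\varepsilon\operatorname{tr}(Q)+t_1+\sqrt n\,t_2-\frac1\eta\right\rceil\ge2,\qquad t_1\ge0,\quad t_2\le0,$$ and $$\begin{pmatrix}\sum_{i=1}^m\mu_iA_i-(t_1+t_2)I-(V+V^T)&M_1&M_2&M_3&M_4\\ M_1^T&-\Phi&V-\Theta&M_5&M_6\\ M_2^T&V^T-\Theta^T&\frac1\eta I-Q&M_7&M_8\\ M_3^T&M_5^T&M_7^T&I&\Theta\\ M_4^T&M_6^T&M_8^T&\Theta^T&Q\end{pmatrix}\succeq0,$$ then $x=0$ is the only solution $x\in\mathbb{R}^n$ to the system of quadratic equations $x^TA_ix=0$, $i=1,\dots,m$.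
   Context: $S^n$ is the set of real symmetric $n\times n$ matrices, $I$ is the $n\times n$ identity matrix, $A\succeq0$ means $A$ is symmetric positive semidefinite, and $\lceil\cdot\rceil$ is the ceiling function. *)

(* Defs.v *)
From mathcomp Require Import all_boot all_order all_algebra.
From mathcomp Require Import reals.

Set Implicit Arguments.
Unset Strict Implicit.
Unset Printing Implicit Defensive.

Import Order.TTheory GRing.Theory Num.Theory.
Local Open Scope ring_scope.

Definition quad_form (R : realType) (n : nat) (A : 'M[R]_n) (x : 'cV[R]_n) : R :=
  (x^T *m A *m x) 0 0.

(* Symmetry is part of positive semidefiniteness. *)
Definition psdmx (R : realType) (n : nat) (A : 'M[R]_n) : Prop :=
  A \is symmetricmx /\ forall x : 'cV[R]_n, 0 <= quad_form A x.

Definition row5 (R : realType) (n : nat) (B1 B2 B3 B4 B5 : 'M[R]_n)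
    : 'M[R]_(n, n + (n + (n + (n + n)))) :=
  row_mx B1 (row_mx B2 (row_mx B3 (row_mx B4 B5))).

Definition col5 (R : realType) (n p : nat) (C1 C2 C3 C4 C5 : 'M[R]_(n, p))
    : 'M[R]_(n + (n + (n + (n + n))), p) :=
  col_mx C1 (col_mx C2 (col_mx C3 (col_mx C4 C5))).

(* Main.v *)
(** If [x <> 0] solved the system, put [s = x^T x > 0] and test the positive
    semidefinite block matrix on the vectors (x,0,0,0,0), (0,x,x,0,0) and
    (0,0,0,x,x), which avoid every [M_i].  Adding the three inequalities cancels
    [Theta], [Q] and [V] and leaves
    [(1 + 1/eta - t1 - t2) s - x^T Phi x >= 0].  Since [- Phi] is positive
    semidefinite, [- x^T Phi x <= - tr(Phi) s]; with [tr(Q) >= 0] and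
    [sqrt n * t2 <= t2] the expression under the ceiling is therefore at
    most 1, whereas a ceiling of at least 2 forces it above 1. *)
Require Import Defs.
From mathcomp Require Import all_boot all_order all_algebra.
From mathcomp Require Import reals.
From mathcomp Require Import ring lra.

Set Implicit Arguments.
Unset Strict Implicit.
Unset Printing Implicit Defensive.

Import Order.TTheory GRing.Theory Num.Theory.
Local Open Scope ring_scope.

Lemma quad_formE (R : realType) (n : nat) (P : 'M[R]_n) (x : 'cV[R]_n) :
  quad_form P x = \sum_i \sum_j P i j * x i 0 * x j 0.
Proof.
rewrite /quad_form mxE exchange_big; apply: eq_bigr => j _.
by rewrite mxE mulr_suml; apply: eq_bigr => i _; rewrite mxE [x i 0 * _]mulrC.
Qed.

Lemma quad_formD (R : realType) (n : nat) (P S : 'M[R]_n) (x : 'cV[R]_n) :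
  quad_form (P + S) x = quad_form P x + quad_form S x.
Proof. by rewrite /quad_form mulmxDr mulmxDl mxE. Qed.

Lemma quad_formN (R : realType) (n : nat) (P : 'M[R]_n) (x : 'cV[R]_n) :
  quad_form (- P) x = - quad_form P x.
Proof. by rewrite /quad_form mulmxN mulNmx mxE. Qed.

Lemma quad_formZ (R : realType) (n : nat) (a : R) (P : 'M[R]_n) (x : 'cV[R]_n) :
  quad_form (a *: P) x = a * quad_form P x.
Proof. by rewrite /quad_form -scalemxAr -scalemxAl mxE. Qed.

Lemma quad_form_tr (R : realType) (n : nat) (P : 'M[R]_n) (x : 'cV[R]_n) :
  quad_form P^T x = quad_form P x.
Proof.
rewrite !quad_formE exchange_big; apply: eq_bigr => i _; apply: eq_bigr => j _.
by rewrite mxE mulrAC.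
Qed.

Lemma quad_form_sum (R : realType) (n m : nat) (P : 'I_m -> 'M[R]_n)
    (x : 'cV[R]_n) :
  quad_form (\sum_i P i) x = \sum_i quad_form (P i) x.
Proof. by rewrite /quad_form mulmx_sumr mulmx_suml summxE. Qed.

Lemma quad_form_scalar (R : realType) (n : nat) (a : R) (x : 'cV[R]_n) :
  quad_form a%:M x = a * quad_form 1%:M x.
Proof. by rewrite -quad_formZ scalemx1. Qed.

Lemma quad_form1 (R : realType) (n : nat) (x : 'cV[R]_n) :
  quad_form 1%:M x = \sum_i x i 0 ^+ 2.
Proof.
by rewrite /quad_form mulmx1 mxE; apply: eq_bigr => i _; rewrite mxE expr2.
Qed.

Lemma quad_form1_gt0 (R : realType) (n : nat) (x : 'cV[R]_n) :
  x != 0 -> 0 < quad_form 1%:M x.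
Proof.
move=> x0; rewrite quad_form1 lt_def sumr_ge0 ?andbT; last first.
  by move=> i _; exact: sqr_ge0.
apply: contra x0; rewrite psumr_eq0; last by move=> i _; exact: sqr_ge0.
move=> /allP h; apply/eqP/colP => i; rewrite mxE; apply/eqP.
by have := h i (mem_index_enum i); rewrite sqrf_eq0.
Qed.

(** Test vectors supported on two coordinates: they reach the diagonal entries and the sums
    [P i j + P j i], which is all that both trace lemmas below require. *)
Lemma quad_form_delta2 (R : realType) (n : nat) (P : 'M[R]_n) (i j : 'I_n)
    (a b : R) :
  quad_form P (a *: delta_mx i 0 - b *: delta_mx j 0) =
  a ^+ 2 * P i i + b ^+ 2 * P j j - a * b * (P i j + P j i).
Proof.
have E k l : ((delta_mx k 0 : 'cV[R]_n)^T *m P *m (delta_mx l 0 : 'cV[R]_n)) 0 0 = P k l.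
  by rewrite trmx_delta -rowE -colE !mxE.
rewrite /quad_form [(_ - _)^T]linearB /= ![(_ *: _)^T]linearZ /=.
rewrite !(mulmxBl, mulmxBr) -!scalemxAl -!scalemxAr.
have addE (X Y : 'M[R]_1) : (X - Y) 0 0 = X 0 0 - Y 0 0 by rewrite !mxE.
have scaleE c (X : 'M[R]_1) : (c *: X) 0 0 = c * X 0 0 by rewrite mxE.
rewrite !(addE, scaleE, E); ring.
Qed.

Lemma psd_trace_ge0 (R : realType) (n : nat) (P : 'M[R]_n) :
  (forall x, 0 <= quad_form P x) -> 0 <= \tr P.
Proof.
move=> hP; apply: sumr_ge0 => i _.
(* With coefficients 1 and 0 the two-term formula collapses to [P i i]. *)
have := hP (1 *: delta_mx i 0 - 0 *: delta_mx i 0); rewrite quad_form_delta2.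
lra.
Qed.

(* Summing [q(x_j e_i - x_i e_j) >= 0] over all [i, j] gives
   [2 (tr P * |x|^2 - q(x)) >= 0]. *)
Lemma psd_quad_form_le_trace (R : realType) (n : nat) (P : 'M[R]_n)
    (x : 'cV[R]_n) :
  (forall y, 0 <= quad_form P y) ->
  quad_form P x <= \tr P * quad_form 1%:M x.
Proof.
move=> hP.
have : 0 <= \sum_i \sum_j
    quad_form P (x j 0 *: delta_mx i 0 - x i 0 *: delta_mx j 0).
  by apply: sumr_ge0 => i _; apply: sumr_ge0 => j _; exact: hP.
have E1 : \sum_i \sum_j x j 0 ^+ 2 * P i i = \tr P * quad_form 1%:M x.
  rewrite quad_form1 /mxtrace mulr_suml; apply: eq_bigr => i _.
  by rewrite mulr_sumr; apply: eq_bigr => j _; rewrite mulrC.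
have E2 : \sum_i \sum_j x i 0 ^+ 2 * P j j = \tr P * quad_form 1%:M x.
  by rewrite -E1 exchange_big.
(* The entries [P j i] contribute the form of [P^T], which takes the same values. *)
have E3 : \sum_i \sum_j x j 0 * x i 0 * (P i j + P j i) = quad_form P x *+ 2.
  rewrite mulr2n -{2}quad_form_tr !quad_formE -big_split; apply: eq_bigr => i _.
  rewrite -big_split; apply: eq_bigr => j _ /=; rewrite mxE; ring.
under eq_bigr => i _ do under eq_bigr => j _ do rewrite quad_form_delta2.
under eq_bigr => i _ do rewrite sumrB big_split /=.
rewrite sumrB big_split /= E1 E2 E3; lra.
Qed.

(** Each conclusion comes from a vector whose block components are [x] or 0; repeating [x] in two
    positions adds up the four blocks that they span. [B22] and [B55] will be [- Phi] and [Q]. *)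
Lemma psd_col5_blocks (R : realType) (n : nat)
    (B11 B12 B13 B14 B15 B21 B22 B23 B24 B25 B31 B32 B33 B34 B35
     B41 B42 B43 B44 B45 B51 B52 B53 B54 B55 : 'M[R]_n) :
  (forall y, 0 <= quad_form
    (col5 (row5 B11 B12 B13 B14 B15) (row5 B21 B22 B23 B24 B25)
          (row5 B31 B32 B33 B34 B35) (row5 B41 B42 B43 B44 B45)
          (row5 B51 B52 B53 B54 B55)) y) ->
  (forall x, 0 <= quad_form B11 x) /\ (forall x, 0 <= quad_form B22 x) /\
  (forall x, 0 <= quad_form B55 x) /\
  (forall x, 0 <= quad_form (B22 + B23 + (B32 + B33)) x) /\
  (forall x, 0 <= quad_form (B44 + B45 + (B54 + B55)) x).
Proof.
move=> h.
have E (x1 x2 x3 x4 x5 : 'cV[R]_n) := h (col5 x1 x2 x3 x4 x5).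
rewrite /quad_form /col5 /row5 in E *.
pose simp := (tr_col_mx, mul_row_col, mul_mx_row, trmx0, mul0mx, add_row_mx,
              mulmx0, addr0, add0r).
split=> [x|]; first by have := E x 0 0 0 0; rewrite !simp.
split=> [x|]; first by have := E 0 x 0 0 0; rewrite !simp.
split=> [x|]; first by have := E 0 0 0 0 x; rewrite !simp.
split=> x.
  by have := E 0 x x 0 0; rewrite !simp !mulmxDr !mulmxDl addrACA.
by have := E 0 0 0 x x; rewrite !simp !mulmxDr !mulmxDl addrACA.
Qed.

Theorem theorem4p3 (R : realType) (n m : nat) (A : 'I_m -> 'M[R]_n)
  (hA : forall i, A i \is symmetricmx)
  (hcert : exists (eta eps t1 t2 : R) (mu : 'I_m -> R)
      (Phi Q V Theta M1 M2 M3 M4 M5 M6 M7 M8 : 'M[R]_n),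
    [/\ 0 < eta, 0 < eps, Phi \is symmetricmx & Q \is symmetricmx] /\
    [/\ 2 <= Num.ceil (\tr Phi - eps * \tr Q + t1
                       + Num.sqrt (n%:R : R) * t2 - 1 / eta),
        0 <= t1,
        t2 <= 0 &
        psdmx (col5
          (row5 (\sum_(i < m) mu i *: A i - (t1 + t2)%:M - (V + V^T))
                     M1      M2                    M3     M4)
          (row5 M1^T (- Phi) (V - Theta)           M5     M6)
          (row5 M2^T (V^T - Theta^T) ((1 / eta)%:M - Q) M7 M8)
          (row5 M3^T M5^T    M7^T                  1%:M   Theta)
          (row5 M4^T M6^T    M8^T                  Theta^T Q))]) :
  forall x : 'cV[R]_n, (forall i, quad_form (A i) x = 0) <-> x = 0.
Proof.
move=> x; split=> [hx|-> i]; last by rewrite /quad_form mulmx0 mxE.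
case: hcert => eta [eps [t1 [t2 [mu [Phi [Q [V [Theta]]]]]]]].
case=> M1 [M2 [M3 [M4 [M5 [M6 [M7 [M8]]]]]]].
case=> -[eta0 eps0 _ _] [hceil ht1 ht2 [_ hpsd]].
apply/eqP/negP => /negP x0; have s0 := quad_form1_gt0 x0.
have [hB [hPhi [hQ [h23 h45]]]] := psd_col5_blocks hpsd.
(* The combination of the [A i] vanishes at [x], and [V^T] counts as a second [V]. *)
have {hB}h1 : (t1 + t2) * quad_form 1%:M x + 2 * quad_form V x <= 0.
  have := hB x; rewrite !(quad_formD, quad_formN) quad_form_sum big1.
    rewrite quad_form_tr quad_form_scalar; lra.
  by move=> i _; rewrite quad_formZ hx mulr0.
have {h23} := h23 x; have {h45} := h45 x.
rewrite !(quad_formD, quad_formN) !quad_form_tr.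
rewrite (quad_form_scalar (1 / eta)) => h45 h23.
have hle := psd_quad_form_le_trace x hPhi.
rewrite quad_formN linearN /= in hle.
(* [h23] and [h45] together cancel [Theta] and [Q]; [h1] then removes [V], and [hle] trades the form
   of [Phi] for its trace. *)
have hsum : (t1 + t2 + \tr Phi - 1 / eta - 1) * quad_form 1%:M x <= 0 by lra.
rewrite pmulr_lle0 // in hsum.
have htrQ : 0 <= eps * \tr Q by rewrite mulr_ge0 ?psd_trace_ge0 // ltW.
(* A nonzero [x] excludes dimension 0. *)
have n1 : 1 <= Num.sqrt (n%:R : R).
  rewrite -{1}[1]sqrtr1 ler_sqrt ?ler0n // ler1n lt0n.
  by apply: contra x0 => /eqP n0; subst n; rewrite flatmx0.
have hsq : Num.sqrt (n%:R : R) * t2 <= t2 by nra.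
suff : 1 < \tr Phi - eps * \tr Q + t1 + Num.sqrt (n%:R : R) * t2 - 1 / eta.
  lra.
(* For an integer, at least 2 means above 1, and a ceiling exceeds the integer 1 exactly when its
   argument does. *)
by rewrite -[1](mulr1z 1) -ceil_gt_int.
Qed.
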